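(* Let $0<p<1$, let $H_0,H_1$ be probability distributions on $\mathbb{R}$ with expected values $\mu(H_0)=0$, $\mu(H_1)=1$, and let $X_1,X_2,\ldots$ be obtained from $H_0,H_1$ by exponential sampling, as defined in the context. For $n\ge 1$ let $\bar X_n=\frac{1}{2^n-1}\sum_{i=1}^{2^n-1}X_i$. If $H_0$ and $H_1$ both have finite variances, then $W(p)$ is the limit distribution of the stochastic process $(\bar X_n)$, i.e. $\bar X_n$ converges in distribution to $W(p)$ as $n\to\infty$.
   Context: Exponential sampling: Given two parent distributions $H_0,H_1$ and $0<p<1$, let $B_0,B_1,B_2,\ldots$ be independent Bernoulli random variables with $P(B_j=1)=p$, $P(B_j=0)=1-p$. The sample $X_1;X_2,X_3;X_4,\ldots,X_7;\ldots;X_{2^{n-1}},\ldots,X_{2^n-1}$ of size $2^n-1$ consists of $n$ sub-samples, where sub-sample $j$ ($j=1,\ldots,n$) consists of the $2^{j-1}$ variables $X_{2^{j-1}},\ldots,X_{2^j-1}$. Conditional on $(B_0,\ldots,B_{n-1})$, all the $X_i$ are independent, and the variables of sub-sample $j$ are all distributed according to $H_1$ if $B_{j-1}=1$ and according to $H_0$ if $B_{j-1}=0$. Weaver's distribution $W(n,p)$ ($n\ge 1$): the discrete distribution on the points $y_{k,n}=k/(2^n-1)$, $k=0,\ldots,2^n-1$, with probabilities $p_k=p^{\#1}(1-p)^{\#0}$, where $\#1$ and $\#0$ are the numbers of ones and zeros in the $n$-digit binary representation of $k$. The weaver's hem $W(p)$ is the distribution whose distribution function is the pointwise limit $F=\lim_{n\to\infty}F_n$,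 where $F_n$ is the distribution function of $W(n,p)$. *)

(* Defs.v *)
From mathcomp Require Export all_boot all_order all_algebra finmap.
From mathcomp Require Export all_classical all_reals all_analysis measurable_realfun.

Set Implicit Arguments.
Unset Strict Implicit.
Unset Printing Implicit Defensive.

Import Order.TTheory GRing.Theory Num.Theory.
Import numFieldNormedType.Exports.

Local Open Scope classical_set_scope.
Local Open Scope ring_scope.

Definition law_on_R (R : realType) := probability R R.

Definition distr_fun (R : realType) (Q : set R -> \bar R) (x : R) : \bar R :=
  Q `]-oo, x]%classic.

Definition cvg_in_distribution (R : realType) (Q : nat -> law_on_R R)
    (W : law_on_R R) : Prop :=
  forall x : R, {for x, continuous (distr_fun W)} ->
    distr_fun (Q n) x @[n --> \oo] --> distr_fun W x.

Section weaver.
Context {R : realType}.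

Definition num_ones (n k : nat) : nat := (\sum_(j < n) odd (k %/ 2 ^ j))%N.

Definition weaver_point (n k : nat) : R := k%:R / (2 ^+ n - 1).

Definition weaver_weight (n : nat) (p : R) (k : nat) : R :=
  p ^+ num_ones n k * (1 - p) ^+ (n - num_ones n k).

Definition weaver (n : nat) (p : R) (A : set R) : \bar R :=
  (\sum_(k < 2 ^ n) (weaver_weight n p k)%:E * \d_(weaver_point n k) A)%E.

(* "The" law whose distribution function is the pointwise limit of those of
   weaver n p.  A law on R is determined by its distribution function, so the
   choice made by xget is immaterial; the Dirac mass is only the default value
   that makes the definition total. *)
Definition weavers_hem (p : R) : law_on_R R :=
  xget (@dirac _ R 0 R : law_on_R R)
    [set W : law_on_R R |
      forall x : R, distr_fun (weaver n p) x @[n --> \oo] --> distr_fun W x].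

End weaver.

(* Q is a set function rather than a probability so that the notion also
   applies to conditional probabilities. *)
Definition mutually_independent d d' (T : measurableType d)
    (T' : measurableType d') (R : realType) (Q : set T -> \bar R)
    (D : set nat) (Y : nat -> T -> T') : Prop :=
  forall J : {fset nat}, [set` J] `<=` D ->
  forall A : nat -> set T', (forall j, measurable (A j)) ->
    (Q (\bigcap_(j in [set` J]) Y j @^-1` A j) =
     \prod_(j <- J) Q (Y j @^-1` A j))%E.

Definition cond_prob d (T : measurableType d) (R : realType)
    (P : probability T R) (C A : set T) : \bar R :=
  (P (A `&` C) / P C)%E.

Section exponential_sampling.
Context d (T : measurableType d) (R : realType) (P : probability T R).

(* X i is meaningful for i >= 1 only.  The index i belongs to sub-sample j
   iff 2 ^ (j - 1) <= i < 2 ^ j, i.e. j - 1 = trunc_log 2 i.  The conditioning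
   events have positive probability when 0 < p < 1. *)
Definition exponential_sampling (p : R) (H0 H1 : law_on_R R)
    (B : nat -> {RV P >-> bool}) (X : nat -> {RV P >-> R}) : Prop :=
  [/\ mutually_independent P setT (fun j => B j : T -> bool),
      forall j, P [set w | B j w = true] = p%:E &
      forall (n : nat) (b : nat -> bool),
        let Pb := cond_prob P [set w | forall j, (j < n)%N -> B j w = b j] in
        mutually_independent Pb [set i | (1 <= i < 2 ^ n)%N]
          (fun i => X i : T -> R) /\
        forall i, (1 <= i < 2 ^ n)%N ->
          forall A : set (R), measurable A ->
            Pb (X i @^-1` A) = (if b (trunc_log 2 i) then H1 else H0) A].

Definition sample_mean (X : nat -> {RV P >-> R}) (n : nat) : {RV P >-> R} :=
  (2 ^+ n - 1)^-1 \o* (\sum_(1 <= i < 2 ^ n) (X i : {mfun T >-> R}))%R.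

End exponential_sampling.

(* Main.v *)
From HB Require Import structures.
Require Import Defs.
From mathcomp Require Import ring lra.
From mathcomp Require Import zify.
(** Let S_n be the sample mean and let K_n = sum_(j < n) B_j 2^j be the number
whose binary digits are the first n Bernoulli variables.

Conditionally on B_0, ..., B_(n-1) the mean of S_n is K_n / (2^n - 1), since
sub-sample j + 1 contributes 2^j variables of mean B_j; this is the point
[weaver_point n K_n], and K_n = k has probability [weaver_weight n p k].  So the
conditional mean follows W(n,p) exactly.  Given these digits the 2^n - 1
observations are independent with variance at most some v, hence the
conditional variance of S_n is at most v / (2^n - 1), and Chebyshev's inequality
bounds the conditional probability of [|S_n - K_n / (2^n - 1)| >= delta] by
v / delta^2 / (2^n - 1) ([sample_mean_deviation]).  Averaging over the digits,
the distribution function of S_n at x lies between those of W(n,p) at x - delta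
and at x + delta, up to an error that vanishes as n grows
([distr_near_weaver_cdf]); continuity of the limit at x concludes
([cvg_between_shifts]).

It remains to see that W(p) exists, that is, that the distribution functions of
W(n,p) converge at every point to that of a law.  The same Bernoulli variables
provide the law: let U = sum_j B_j / 2^(j+1).  Reading the first n digits in the
reverse order does not change the law of the integer they form, and the integer
so obtained, divided by 2^n - 1, is within 2^-n of U.  Therefore the
distribution functions of U and of W(n,p) agree up to shifts of size 2 / 2^n.
A half-open interval of that length contains at most two points of W(n,p), each of mass
at most max(p, 1-p)^n, so the shifts cost at most 2 max(p, 1-p)^n
([weaver_cdf_near_binary_limit]).  This gives the convergence at every point,
continuity points or not. *)

Import Order.TTheory GRing.Theory Num.Theory.
Import numFieldNormedType.Exports.
Local Open Scope classical_set_scope.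
Local Open Scope ring_scope.

Set Implicit Arguments.
Unset Strict Implicit.

(** * Variance of a sum of pairwise independent random variables *)

Section independence.
Context d (T : measurableType d) (R : realType) (P : probability T R).

Lemma integrable_distribution (X : {RV P >-> R}) :
  P.-integrable setT (EFin \o X) ->
  (distribution P X).-integrable setT (fun x : R => x%:E).
Proof.
move=> X1; have := @integrable_pushforward _ _ _ _ R X _ P setT EFin.
by rewrite preimage_setT; apply.
Qed.

Definition independent_pair (X Y : T -> R) :=
  forall A B, measurable A -> measurable B ->
    (P (X @^-1` A `&` Y @^-1` B) = P (X @^-1` A) * P (Y @^-1` B))%E.

(** The joint law of independent variables is the product of their laws, so
Fubini's theorem separates the two factors. *)
Lemma expectation_independent_mul (X Y : {RV P >-> R}) :
  (X : T -> R) \in Lfun P 2%:E -> (Y : T -> R) \in Lfun P 2%:E ->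
  independent_pair X Y -> ('E_P[X \* Y] = 'E_P[X] * 'E_P[Y])%E.
Proof.
move=> X2 Y2 XY.
have Pfin : P setT \is a fin_num := fin_num_measure P _ measurableT.
have /Lfun1_integrable X1 := Lfun_subset12 Pfin X2.
have /Lfun1_integrable Y1 := Lfun_subset12 Pfin Y2.
have /Lfun1_integrable XY1 := Lfun2_mul_Lfun1 X2 Y2.
pose phi w := (X w, Y w).
have mphi : measurable_fun setT phi by exact/measurable_fun_pair.
pose f (z : R * R) := (z.1 * z.2)%:E : \bar R.
have mf : measurable_fun setT f.
  by apply/measurable_EFinP; exact: measurable_funM.
have prodE A : measurable A ->
    (distribution P X \x distribution P Y)%E A = pushforward P phi A.
  by apply: product_measure_unique => B C mB mC; rewrite -XY.
have fint : (pushforward P phi).-integrable setT f.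
  exact: integrable_pushforward.
have fprod : (distribution P X \x distribution P Y)%E.-integrable setT f.
  apply/integrableP; split=> //; move/integrableP: fint => [_].
  congr (_ < _)%E; apply: eq_measure_integral => A mA _.
  exact/esym/prodE.
have -> : ('E_P[X \* Y] =
    \int[distribution P X \x distribution P Y]_z f z)%E.
  rewrite (eq_measure_integral (pushforward P phi)); last first.
    by move=> A mA _; exact: prodE.
  by rewrite integral_pushforward// unlock.
rewrite -integral12_prod_meas1//.
have EX (Z : {RV P >-> R}) : P.-integrable setT (EFin \o Z) ->
    (\int[distribution P Z]_x x%:E = 'E_P[Z])%E.
  by move=> Z1; rewrite integral_distribution// unlock.
have EY : ('E_P[Y] \is a fin_num)%E by exact/expectation_fin_num/Lfun1_integrable.
have idX : (distribution P X).-integrable setT (fun x : R => x%:E).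
  exact: integrable_distribution.
have idY : (distribution P Y).-integrable setT (fun x : R => x%:E).
  exact: integrable_distribution.
under eq_integral => x _.
  rewrite /fubini_F /f /=.
  under eq_integral do rewrite EFinM.
  rewrite integralZl// EX//; over.
by rewrite -(fineK EY) integralZr// EX.
Qed.

Lemma independent_covariance0 (X Y : {RV P >-> R}) :
  (X : T -> R) \in Lfun P 2%:E -> (Y : T -> R) \in Lfun P 2%:E ->
  independent_pair X Y -> covariance P X Y = 0%E.
Proof.
move=> X2 Y2 XY.
have Pfin : P setT \is a fin_num := fin_num_measure P _ measurableT.
have X1 := Lfun_subset12 Pfin X2; have Y1 := Lfun_subset12 Pfin Y2.
rewrite covarianceE//; last exact: Lfun2_mul_Lfun1.
rewrite (expectation_independent_mul X2 Y2 XY) subee//.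
by rewrite fin_numM ?expectation_fin_num.
Qed.

Lemma Lfun2D (f g : T -> R) : f \in Lfun P 2%:E -> g \in Lfun P 2%:E ->
  f \+ g \in Lfun P 2%:E.
Proof. exact: (Lfun_addr_closed P (lee1n 2)).2. Qed.

Lemma sum_Lfun2 (I : eqType) (s : seq I) (X : I -> {RV P >-> R}) :
  (forall i, i \in s -> (X i : T -> R) \in Lfun P 2%:E) ->
  (fun w => \sum_(i <- s) X i w) \in Lfun P 2%:E.
Proof.
elim: s => [|i s IH] X2.
  rewrite (_ : (fun w => _) = cst 0) ?Lfun_cst//.
  by apply/funext => w; rewrite big_nil.
rewrite (_ : (fun w => _) = (X i : T -> R) \+ (fun w => \sum_(j <- s) X j w)).
  by apply: Lfun2D; [rewrite X2// mem_head|
    apply: IH => j js; rewrite X2// inE js orbT].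
by apply/funext => w; rewrite big_cons.
Qed.

Lemma expectation_sum_seq (I : eqType) (s : seq I) (X : I -> {RV P >-> R}) :
  (forall i, i \in s -> (X i : T -> R) \in Lfun P 2%:E) ->
  ('E_P[fun w => (\sum_(i <- s) X i w)%R] = \sum_(i <- s) 'E_P[X i])%E.
Proof.
have Pfin : P setT \is a fin_num := fin_num_measure P _ measurableT.
elim: s => [|i s IH] X2.
  rewrite big_nil -[RHS](expectation_cst P 0); congr expectation.
  by apply/funext => w; rewrite big_nil.
have X2s j : j \in s -> (X j : T -> R) \in Lfun P 2%:E.
  by move=> js; rewrite X2// inE js orbT.
rewrite big_cons -IH// -expectationD.
- by congr expectation; apply/funext => w; rewrite big_cons.
- by rewrite (Lfun_subset12 Pfin)// X2// mem_head.
- by rewrite (Lfun_subset12 Pfin)// sum_Lfun2.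
Qed.

(** Only the covariances of pairs enter the variance of a sum, so pairwise
independence is enough. *)
Lemma variance_sum_independent (I : eqType) (s : seq I)
    (X : I -> {RV P >-> R}) : uniq s ->
  (forall i, i \in s -> (X i : T -> R) \in Lfun P 2%:E) ->
  (forall i j, i \in s -> j \in s -> i != j -> independent_pair (X i) (X j)) ->
  ('V_P[fun w => (\sum_(i <- s) X i w)%R] = \sum_(i <- s) 'V_P[X i])%E.
Proof.
elim: s => [|i s IH] /=.
  move=> _ _ _; rewrite big_nil -[RHS](variance_cst P 0); congr variance.
  by apply/funext => w; rewrite big_nil.
move=> /andP[nis us] X2 XX.
have X2s j : j \in s -> (X j : T -> R) \in Lfun P 2%:E.
  by move=> js; rewrite X2// inE js orbT.
have X2i : (X i : T -> R) \in Lfun P 2%:E by rewrite X2// mem_head.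
have XXi j : j \in s -> covariance P (X i) (X j) = 0%E.
  move=> js; apply: independent_covariance0; [by []|exact: X2s|].
  by apply: XX; rewrite ?inE ?eqxx ?js ?orbT//; apply: contraNneq nis => ->.
rewrite big_cons -IH//; last first.
  by move=> j k js ks; apply: XX; rewrite inE ?js ?ks orbT.
have -> : (fun w => \sum_(j <- i :: s) X j w) =
    (X i : T -> R) \+ (fun w => \sum_(j <- s) X j w).
  by apply/funext => w; rewrite big_cons.
rewrite varianceD ?sum_Lfun2//.
suff -> : covariance P (X i) (fun w => \sum_(j <- s) X j w) = 0%E.
  by rewrite mule0 adde0.
elim: s X2s XXi {nis us X2 XX IH} => [|j s IH] X2s XXi.
  rewrite -[RHS](covariance_cst_r P (X i) 0); congr covariance.
  by apply/funext => w; rewrite big_nil.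
have -> : (fun w => \sum_(k <- j :: s) X k w) =
    (X j : T -> R) \+ (fun w => \sum_(k <- s) X k w).
  by apply/funext => w; rewrite big_cons.
have X2s' k : k \in s -> (X k : T -> R) \in Lfun P 2%:E.
  by move=> ks; rewrite X2s// inE ks orbT.
rewrite covarianceDr ?sum_Lfun2// ?X2s ?mem_head// XXi ?mem_head// add0e.
by apply: IH => // k ks; rewrite XXi// inE ks orbT.
Qed.

(** The centred variable is square-integrable, and so are constants. *)
Lemma variance_lty_Lfun2 (X : {RV P >-> R}) :
  ('V_P[X] < +oo)%E -> (X : T -> R) \in Lfun P 2%:E.
Proof.
move=> VX; pose c := fine ('E_P[X])%E.
have Y2 : (X \- cst c : T -> R) \in Lfun P 2%:E.
  have mY : measurable_fun setT (X \- cst c : T -> R).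
    exact: measurable_funB.
  rewrite inE; apply/andP; split; first by rewrite inE.
  rewrite inE/= /finite_norm unlock poweR_lty//.
  move: VX; rewrite /variance !unlock; congr (_ < _)%E.
  apply: eq_integral => w _ /=; rewrite powR_mulrn// real_normK ?num_real//.
  by rewrite /c unlock.
have -> : (X : T -> R) = (X \- cst c) \+ cst c.
  by apply/funext => w /=; rewrite subrK.
by apply: Lfun2D; [exact: Y2|exact: Lfun_cst].
Qed.

End independence.

(** * Laws and conditional probabilities *)

Section transfer.
Context d (T : measurableType d) (R : realType) (Q : probability T R).
Variables (H : probability R R) (X : {RV Q >-> R}).
Hypothesis XH : forall A : set R, measurable A -> Q (X @^-1` A) = H A.

Lemma ge0_integral_law (f : R -> \bar R) : measurable_fun setT f ->
  (forall x, 0 <= f x)%E -> (\int[Q]_w f (X w) = \int[H]_x f x)%E.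
Proof.
move=> mf f0; rewrite -(@ge0_integral_distribution _ _ _ _ _ Q X)//.
by apply: eq_measure_integral => A mA _; exact: XH.
Qed.

Lemma expectation_law : H.-integrable setT (fun x : R => x%:E) ->
  ('E_Q[X] = 'E_H[fun x => x])%E.
Proof.
move=> /integrableP[mid Hid]; have iX : Q.-integrable setT (EFin \o X).
  apply/integrableP; split; first exact/measurable_EFinP.
  rewrite [ltLHS](ge0_integral_law (f := fun x : R => `|x%:E|%E))//.
  exact: measurableT_comp.
rewrite unlock -(@integral_distribution _ _ _ _ _ Q X EFin)//.
by apply: eq_measure_integral => A mA _; exact: XH.
Qed.

Lemma variance_law : H.-integrable setT (fun x : R => x%:E) ->
  ('V_Q[X] = 'V_H[fun x => x])%E.
Proof.
move=> H1; rewrite /variance !covariance.unlock expectation_law//.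
set c := fine _; rewrite !expectation.unlock.
apply: (ge0_integral_law (f := fun x : R => ((x - c) * (x - c))%:E)).
  apply/measurable_EFinP.
  by apply: measurable_funM; apply: measurable_funB.
by move=> x; rewrite lee_fin -expr2 sqr_ge0.
Qed.

End transfer.

(** Conditioning on an event of positive probability yields a genuine
probability measure, so that moments and Chebyshev's inequality are available
under the conditional law. *)
Lemma cond_prob_probability d (T : measurableType d) (R : realType)
    (P : probability T R) (C : set T) : measurable C -> (0 < P C)%E ->
  exists Q : probability T R, Q = cond_prob P C :> (set T -> \bar R).
Proof.
move=> mC PC; exists (mnormalize (mrestr P mC) P).
have PCfin : P C \is a fin_num by exact: fin_num_measure.
apply/funext => A.
rewrite -[LHS]/((if (P (setT `&` C) == 0) || (P (setT `&` C) == +oo) then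
  (fun U => P U)
  else fun U => P (U `&` C) * (fine (P (setT `&` C)))^-1%:E) A)%E.
rewrite setTI gt_eqF//= ifF; last first.
  by apply/negP => /eqP PCy; move: PCfin; rewrite PCy.
rewrite /cond_prob; congr (_ * _)%E.
by rewrite -{2}(fineK PCfin) inver gt_eqF// fine_gt0// PC ltey_eq PCfin.
Qed.

(** * Binary digits *)

Definition digit_sum (n : nat) (b : nat -> bool) : nat :=
  (\sum_(j < n) b j * 2 ^ j)%N.

Lemma digit_sumS n b : (digit_sum n.+1 b = digit_sum n b + b n * 2 ^ n)%N.
Proof. by rewrite /digit_sum big_ord_recr. Qed.

Lemma digit_sum_lt n b : (digit_sum n b < 2 ^ n)%N.
Proof.
elim: n => [|n IH]; first by rewrite /digit_sum big_ord0.
rewrite digit_sumS expnS mul2n -addnn -addSn leq_add//.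
by case: (b n); rewrite ?mul1n ?mul0n.
Qed.

Lemma digit_sumK n b j : (j < n)%N -> odd (digit_sum n b %/ 2 ^ j) = b j.
Proof.
elim: n => // n IH; rewrite ltnS digit_sumS leq_eqVlt => /orP[/eqP ->|jn].
  rewrite addnC divnMDl ?expn_gt0// divn_small ?digit_sum_lt// addn0.
  by case: (b n).
have -> : (2 ^ n = 2 ^ (n - j) * 2 ^ j)%N by rewrite -expnD subnK// ltnW.
rewrite mulnA addnC divnMDl ?expn_gt0//.
by rewrite oddD IH// oddM oddX /= subn_eq0 leqNgt jn /= andbF.
Qed.

Lemma digit_sum_digits n k : (k < 2 ^ n)%N ->
  digit_sum n (fun j => odd (k %/ 2 ^ j)) = k.
Proof.
move=> kn; rewrite -[RHS](modn_small kn) {kn}.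
elim: n => [|n IH]; first by rewrite /digit_sum big_ord0 expn0 modn1.
rewrite digit_sumS IH; set q := (k %/ 2 ^ n)%N; set r := (k %% 2 ^ n)%N.
have -> : k = (q./2 * 2 ^ n.+1 + (r + odd q * 2 ^ n))%N.
  rewrite {1}(divn_eq k (2 ^ n)) -/q -/r -{1}(odd_double_half q) -muln2.
  by rewrite expnS; ring.
rewrite modnMDl modn_small// expnS mul2n -addnn -addSn leq_add//.
  by rewrite ltn_mod expn_gt0.
by case: (odd q); rewrite ?mul1n ?mul0n.
Qed.

Lemma digit_sum_eq n k b : (k < 2 ^ n)%N ->
  digit_sum n b = k <-> forall j, (j < n)%N -> b j = odd (k %/ 2 ^ j).
Proof.
move=> kn; split=> [<- j jn|bk]; first by rewrite digit_sumK.
rewrite -[RHS](digit_sum_digits kn) /digit_sum.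
by apply: eq_bigr => j _; rewrite bk.
Qed.

(** The conditional expectation of the sum of the observations: each of the 2^j
indices i with [trunc_log 2 i = j] contributes the digit of weight 2^j. *)
Lemma sum_trunc_log n (b : nat -> bool) :
  (\sum_(1 <= i < 2 ^ n) b (trunc_log 2 i) = digit_sum n b)%N.
Proof.
elim: n => [|n IH]; first by rewrite /digit_sum big_ord0 big_geq.
rewrite digit_sumS -IH (@big_cat_nat _ _ _ (2 ^ n)%N)/= ?expn_gt0 ?leq_exp2l//.
congr (_ + _)%N; rewrite big_nat_cond (eq_bigr (fun=> b n : nat)).
  by rewrite -big_nat_cond sum_nat_const_nat expnS mul2n -addnn addnK mulnC.
by move=> i; rewrite andbT => /(trunc_log_eq (isT : 1 < 2)%N) ->.
Qed.

Definition rev_digit_sum (n : nat) (b : nat -> bool) : nat :=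
  digit_sum n (fun j => b (n.-1 - j)%N).

(** With the first digit read as the most significant one, a further digit
doubles the number and is added to it: this is what makes the quotients by 2^n
converge, which fails for [digit_sum]. *)
Lemma rev_digit_sumS n (b : nat -> bool) :
  rev_digit_sum n.+1 b = (2 * rev_digit_sum n b + b n)%N.
Proof.
rewrite /rev_digit_sum /digit_sum big_ord_recl subn0 expn0 muln1 addnC big_distrr/=.
congr (_ + _)%N; apply: eq_bigr => j _; rewrite /bump/= expnS mulnCA.
by have -> : (n - (1 + j) = n.-1 - j)%N by lia.
Qed.

(** * The weights of Weaver's distribution *)

Section weaver_weight.
Context (R : realType) (p : R).

Lemma prod_digits n (b : nat -> bool) (q : R) :
  \prod_(j < n) (if b j then p else q) =
  p ^+ (\sum_(j < n) b j)%N * q ^+ (n - \sum_(j < n) b j)%N.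
Proof.
elim: n => [|n IH]; first by rewrite !big_ord0 !expr0 mulr1.
have le_n : (\sum_(j < n) b j <= n)%N.
  rewrite -[X in (_ <= X)%N]card_ord -sum1_card leq_sum// => j _.
  by case: (b j).
rewrite !big_ord_recr/= IH; case: (b n); rewrite /= ?addn1 ?addn0.
  by rewrite subSS exprSr mulrAC.
by rewrite subSn// exprSr mulrA.
Qed.

Lemma weaver_weight_prod n k :
  weaver_weight n p k = \prod_(j < n) (if odd (k %/ 2 ^ j) then p else 1 - p).
Proof. by rewrite (prod_digits n (fun j => odd (k %/ 2 ^ j))). Qed.

Hypotheses (p0 : 0 < p) (p1 : p < 1).

Lemma weaver_weight_gt0 n k : 0 < weaver_weight n p k.
Proof. by rewrite mulr_gt0 ?exprn_gt0// subr_gt0. Qed.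

Lemma weaver_weight_le n k : weaver_weight n p k <= Num.max p (1 - p) ^+ n.
Proof.
rewrite weaver_weight_prod -[in leRHS](card_ord n) -prodr_const.
apply: ler_prod => j _; case: ifP => _.
  by rewrite (ltW p0) le_max lexx.
by rewrite subr_ge0 (ltW p1) le_max lexx orbT.
Qed.
End weaver_weight.

(** * The distribution function of Weaver's distribution *)

Section weaver_distribution_function.
Context (R : realType) (p : R).
Hypotheses (p0 : 0 < p) (p1 : p < 1).

Definition weaver_cdf n x : R :=
  \sum_(k < 2 ^ n) weaver_weight n p k * (weaver_point n k <= x :> R)%:R.

Lemma distr_fun_weaver n x :
  distr_fun (weaver n p) x = (weaver_cdf n x)%:E.
Proof.
rewrite /distr_fun /weaver /weaver_cdf -sumEFin; apply: eq_bigr => k _.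
rewrite diracE EFinM; congr (_ * (nat_of_bool _)%:R%:E)%E.
by apply/idP/idP => [/set_mem|h]; [|apply/mem_set]; rewrite /= in_itv.
Qed.

Lemma sum_window N t : (\sum_(k < N) (t <= k < t + 2) <= 2)%N.
Proof.
suff -> : (\sum_(k < N) (t <= k < t + 2) = minn 2 (N - t))%N by lia.
elim: N => [|N IH]; first by rewrite big_ord0; lia.
by rewrite big_ord_recr/= IH; lia.
Qed.

(** The points of W(n,p) are 1 / (2^n - 1) apart, so a shift by less than
2 / (2^n - 1) meets at most two of them, each of mass at most
max(p, 1-p)^n. *)
Lemma weaver_cdf_increment n x delta : (0 < n)%N ->
  delta * (2 ^+ n - 1) < 2 ->
  weaver_cdf n (x + delta) <= weaver_cdf n x + 2 * Num.max p (1 - p) ^+ n.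
Proof.
move=> n0 dn; set q := Num.max p (1 - p).
have q0 : 0 <= q ^+ n by rewrite exprn_ge0// le_max (ltW p0).
have N0 : 0 < 2 ^+ n - 1 :> R by rewrite subr_gt0 exprn_egt1// -?lt0n// ltr1n.
set a := x * (2 ^+ n - 1).
(* The points crossed by the shift have an index k with a < k < a + 2; t is the
   least natural number above a, which is 0 when a is negative. *)
pose t := if 0 <= a then (Num.trunc a).+1 else 0%N.
have windowP (k : 'I_(2 ^ n)) :
    weaver_weight n p k * (weaver_point n k <= x + delta :> R)%:R <=
    weaver_weight n p k * (weaver_point n k <= x :> R)%:R +
    q ^+ n * (t <= k < t + 2)%N%:R.
  have w0 := ltW (weaver_weight_gt0 p0 p1 n k).
  have [kx|kx] := leP (weaver_point n k) x.
    rewrite (@le_trans _ _ (weaver_weight n p k * 1))//.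
      by rewrite ler_wpM2l// lern1 leq_b1.
    by rewrite lerDl mulr_ge0.
  rewrite mulr0 add0r; have [kd|] := leP (weaver_point n k) (x + delta);
    last first.
    by rewrite mulr0 mulr_ge0.
  suff -> : (t <= k < t + 2)%N by rewrite !mulr1 weaver_weight_le.
  move: kx kd; rewrite /weaver_point ltr_pdivlMr// ler_pdivrMr// mulrDl -/a.
  move=> ak kd; have {dn kd} ka2 : k%:R < a + 2 by lra.
  rewrite /t; case: ifP => a0.
    have /andP[ta at1] := truncn_itv a0.
    rewrite -(ltr_nat R) (le_lt_trans ta ak)/=.
    by rewrite -(ltr_nat R) (lt_trans ka2)// !natrD; lra.
  rewrite leq0n/= -(ltr_nat R) (lt_trans ka2)//; move/negbT: a0.
  by rewrite -ltNge; lra.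
apply: (le_trans (ler_sum _ (fun k _ => windowP k))).
rewrite big_split/= lerD2l -mulr_sumr mulrC ler_wpM2r// -natr_sum.
by rewrite ler_nat sum_window.
Qed.

End weaver_distribution_function.

(** * Real numbers with given binary digits *)

Section binary_value.
Context (R : realType).
Implicit Type b : nat -> bool.

Definition binary_approx n b : R := (rev_digit_sum n b)%:R / 2 ^+ n.

Lemma binary_approxS n b :
  binary_approx n.+1 b = binary_approx n b + (b n)%:R / 2 ^+ n.+1.
Proof.
rewrite /binary_approx rev_digit_sumS natrD mulrDl natrM.
by congr (_ + _); rewrite exprS invfM mulrACA divff// mul1r.
Qed.

Definition binary_value b : R := limn (binary_approx ^~ b).

Lemma binary_approx_nondecreasing b : nondecreasing_seq (binary_approx ^~ b).
Proof.
apply/nondecreasing_seqP => n; rewrite binary_approxS lerDl.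
by rewrite divr_ge0// exprn_ge0.
Qed.

(** The approximations augmented by 2^-n are nonincreasing, a new digit
adding at most 2^-(n+1). *)
Lemma binary_approx_tail n m b : (n <= m)%N ->
  binary_approx m b <= binary_approx n b + (2 ^+ n)^-1.
Proof.
move=> nm; suff : binary_approx m b + (2 ^+ m)^-1 <=
    binary_approx n b + (2 ^+ n)^-1.
  by apply: le_trans; rewrite lerDl invr_ge0 exprn_ge0.
elim: m nm => [|m IH]; first by rewrite leqn0 => /eqP ->.
rewrite leq_eqVlt => /orP[/eqP ->//|/IH]; apply: le_trans.
rewrite binary_approxS -addrA lerD2l exprS invfM.
have : 0 <= (2 ^+ m)^-1 :> R by rewrite invr_ge0 exprn_ge0.
by case: (b m) => /=; lra.
Qed.

Lemma is_cvg_binary_approx b : cvg (binary_approx n b @[n --> \oo]).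
Proof.
apply: nondecreasing_is_cvgn; first exact: binary_approx_nondecreasing.
exists (binary_approx 0 b + (2 ^+ 0)^-1) => _ [n _ <-].
exact: binary_approx_tail.
Qed.

Lemma binary_value_ge n b : binary_approx n b <= binary_value b.
Proof.
apply: nondecreasing_cvgn_le; first exact: binary_approx_nondecreasing.
exact: is_cvg_binary_approx.
Qed.

Lemma binary_value_le n b :
  binary_value b <= binary_approx n b + (2 ^+ n)^-1.
Proof.
apply: limr_le; first exact: is_cvg_binary_approx.
by exists n => // m /= nm; exact: binary_approx_tail.
Qed.

(** With k the number formed by the first n digits, both reals lie in
the dyadic interval from k / 2^n to (k + 1) / 2^n; for k / (2^n - 1) this holds
because k <= 2^n - 1. *)
Lemma binary_value_weaver_point n b : (0 < n)%N ->
  `|binary_value b - weaver_point n (rev_digit_sum n b)| <= (2 ^+ n)^-1.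
Proof.
move=> n0; have := binary_value_ge n b; have := binary_value_le n b.
rewrite /binary_approx /weaver_point; set k := rev_digit_sum n b.
have kn : k%:R + 1 <= 2 ^+ n :> R.
  by rewrite natr1 -natrX ler_nat digit_sum_lt.
have N0 : 0 < 2 ^+ n - 1 :> R by rewrite subr_gt0 exprn_egt1// -?lt0n// ltr1n.
have N1 : 0 < 2 ^+ n :> R by rewrite exprn_gt0.
have ge : k%:R / 2 ^+ n <= k%:R / (2 ^+ n - 1) :> R.
  by rewrite ler_wpM2l// lef_pV2 ?posrE//; lra.
have le : k%:R / (2 ^+ n - 1) <= k%:R / 2 ^+ n + (2 ^+ n)^-1 :> R.
  have -> : k%:R / 2 ^+ n + (2 ^+ n)^-1 = (k%:R + 1) / 2 ^+ n :> R.
    by rewrite mulrDl mul1r.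
  rewrite ler_pdivrMr// mulrAC ler_pdivlMr//.
  by nra.
by move=> h1 h2; rewrite ler_norml; lra.
Qed.
End binary_value.

(** * The law of finitely many Bernoulli digits *)

Section bits.
Context d (T : measurableType d) (R : realType) (P : probability T R).
Context (p : R) (B : nat -> {RV P >-> bool}).
Hypothesis indB : mutually_independent P setT (fun j => B j : T -> bool).
Hypothesis PB : forall j, P [set w | B j w = true] = p%:E.

Lemma prob_bits n (b : nat -> bool) :
  P [set w | forall j, (j < n)%N -> B j w = b j] =
  (\prod_(j < n) (if b j then p else 1 - p))%:E.
Proof.
have PBb j : P (B j @^-1` [set b j]) = (if b j then p else 1 - p)%:E.
  case: (b j); first exact: PB.
  have -> : B j @^-1` [set false] = ~` [set w | B j w = true].
    by apply/seteqP; split => w /=; case: (B j w).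
  have mBj : measurable (B j @^-1` [set true]) by exact: measurable_funPTI.
  by rewrite probability_setC// PB.
pose J := [fset j in iota 0 n]%fset.
have inJ j : (j \in J) = (j < n)%N by rewrite inE/= mem_iota.
have -> : [set w | forall j, (j < n)%N -> B j w = b j] =
    \bigcap_(j in [set` J]) B j @^-1` [set b j].
  apply/seteqP; split=> w /= Bw j; first by rewrite /= inJ => /Bw.
  by move=> jn; apply: Bw; rewrite /= inJ.
rewrite (@indB J _ (fun j => [set b j]))//.
rewrite (eq_bigr (fun j => (if b j then p else 1 - p)%:E))//.
rewrite (perm_big (index_iota 0 n)); last first.
  apply: uniq_perm; [exact: fset_uniq|exact: iota_uniq|].
  by move=> j; rewrite [LHS]inJ mem_index_iota.
by rewrite big_mkord prodEFin.
Qed.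

Lemma measurable_bits n (b : nat -> bool) :
  measurable [set w | forall j, (j < n)%N -> B j w = b j].
Proof.
have -> : [set w | forall j, (j < n)%N -> B j w = b j] =
    \bigcap_(j in `I_n) B j @^-1` [set b j].
  by apply/seteqP; split=> w /= Bw j; exact: Bw.
by apply: bigcap_measurableType => j _; exact: measurable_funPTI.
Qed.
End bits.

(** * Random variables that stay near a function of a discrete one *)

Section mixture.
Context d (T : measurableType d) (R : realType) (P : probability T R).
Context (N : nat) (kappa : T -> 'I_N) (y : 'I_N -> R).
Hypothesis mkappa : forall k, measurable (kappa @^-1` [set k]).

Lemma prob_partition (A : set T) : measurable A ->
  (P A = \sum_(k < N) P (A `&` kappa @^-1` [set k]))%E.
Proof.
move=> mA; rewrite -measure_bigsetU_ord//.
- congr (P _); rewrite -bigcup_seq; apply/seteqP; split=> w.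
    by move=> Aw; exists (kappa w) => //=; rewrite mem_index_enum.
  by case=> k _ [].
- by move=> k; exact: measurableI.
- by move=> i j _ _ [w [[_ /= <-] [_ /= <-]]].
Qed.

Variables (Y : {RV P >-> R}) (delta c : R).
Hypothesis c0 : 0 <= c.
Hypothesis Yc : forall k,
  (P ([set w | (delta <= `|Y w - y k|)%R] `&` kappa @^-1` [set k]) <=
   c%:E * P (kappa @^-1` [set k]))%E.

Let mixture (A : set R) : \bar R :=
  (\sum_(k < N) P (kappa @^-1` [set k]) * \d_(y k) A)%E.

Let total : (\sum_(k < N) P (kappa @^-1` [set k]) = 1)%E.
Proof.
rewrite -(@probability_setT _ _ _ P) (prob_partition measurableT).
by apply: eq_bigr => k _; rewrite setTI.
Qed.

Let mdev k : measurable [set w | delta <= `|Y w - y k|].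
Proof.
have mg : measurable_fun setT (fun w => `|Y w - y k|).
  by apply: measurableT_comp => //; exact: measurable_funB.
have -> : [set w | delta <= `|Y w - y k|] =
    (fun w => `|Y w - y k|) @^-1` `[delta, +oo[%classic.
  by apply/seteqP; split=> w /=; rewrite in_itv/= andbT.
by rewrite -[_ @^-1` _]setTI; exact: mg.
Qed.

(** On the event [kappa = k], Y <= x forces y k <= x + delta unless Y is
delta-far from y k, which has conditional probability at most c. *)
Lemma le_distr_mixture x :
  (distr_fun (distribution P Y) x <= distr_fun mixture (x + delta)%R + c%:E)%E.
Proof.
rewrite /distr_fun /mixture -[c%:E]mule1 -total ge0_sume_distrr//.
rewrite -big_split/= /distribution /pushforward prob_partition; last first.
  exact: measurable_funPTI.
apply: lee_sum => k _; rewrite diracE.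
have [yx|yx] := leP (y k) (x + delta).
  rewrite mem_set/= ?in_itv//= mule1 (@le_trans _ _ (P (kappa @^-1` [set k])))//.
    apply: le_measure; rewrite ?inE//.
    by apply: measurableI => //; exact: measurable_funPTI.
  by rewrite leeDl// mule_ge0.
rewrite memNset/= ?in_itv/= ?mule0 ?add0e; last by apply/negP; rewrite -ltNge.
apply: le_trans (Yc k); apply: le_measure; rewrite ?inE.
- by apply: measurableI => //; exact: measurable_funPTI.
- by apply: measurableI; [exact: mdev|exact: mkappa].
- move=> w [/=]; rewrite in_itv/= => Yx kw; split=> //=.
  by rewrite distrC (le_trans _ (ler_norm _))//; lra.
Qed.

Lemma ge_distr_mixture x :
  (distr_fun mixture (x - delta)%R <= distr_fun (distribution P Y) x + c%:E)%E.
Proof.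
rewrite /distr_fun /mixture -[c%:E]mule1 -total ge0_sume_distrr//.
rewrite /distribution /pushforward prob_partition; last first.
  exact: measurable_funPTI.
rewrite -big_split/=; apply: lee_sum => k _; rewrite diracE.
have [yx|yx] := leP (y k) (x - delta); last first.
  rewrite memNset/= ?in_itv/= ?mule0 ?adde_ge0 ?mule_ge0//.
  by apply/negP; rewrite -ltNge.
rewrite mem_set/= ?in_itv//= mule1.
set A := Y @^-1` _ `&` _.
pose D := [set w | delta <= `|Y w - y k|] `&` kappa @^-1` [set k].
have mA : measurable A by apply: measurableI => //; exact: measurable_funPTI.
have mD : measurable D by apply: measurableI; [exact: mdev|exact: mkappa].
apply: le_trans (leeD2l _ (Yc k)).
apply: le_trans (measureU2 P mA mD).
apply: le_measure; rewrite ?inE//; first exact: measurableU.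
move=> w /= kw; have [Yx|Yx] := leP (Y w) x.
  by left; split=> //=; rewrite in_itv.
by right; split=> //=; rewrite (le_trans _ (ler_norm _))//; lra.
Qed.
End mixture.

(** * Bernoulli digits and Weaver's distribution *)

Section weaver_law.
Context d (T : measurableType d) (R : realType) (P : probability T R).
Context (p : R) (B : nat -> {RV P >-> bool}).
Hypothesis indB : mutually_independent P setT (fun j => B j : T -> bool).
Hypothesis PB : forall j, P [set w | B j w = true] = p%:E.
Hypotheses (p0 : 0 < p) (p1 : p < 1).

Definition sampled_digits n (w : T) : 'I_(2 ^ n) :=
  Ordinal (digit_sum_lt n (fun j => B j w)).

Definition sampled_rev_digits n (w : T) : 'I_(2 ^ n) :=
  Ordinal (digit_sum_lt n (fun j => B (n.-1 - j)%N w)).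

Lemma sampled_digitsE n (k : 'I_(2 ^ n)) :
  sampled_digits n @^-1` [set k] =
  [set w | forall j, (j < n)%N -> B j w = odd (k %/ 2 ^ j)].
Proof.
apply/seteqP; split=> w /=.
  by move=> /(congr1 val)/= /(digit_sum_eq _ (ltn_ord k)).
by move=> Bk; apply/val_inj/(digit_sum_eq _ (ltn_ord k)).
Qed.

Lemma sampled_rev_digitsE n (k : 'I_(2 ^ n)) :
  sampled_rev_digits n @^-1` [set k] =
  [set w | forall j, (j < n)%N -> B j w = odd (k %/ 2 ^ (n.-1 - j))].
Proof.
have rev j : (j < n)%N -> (n.-1 - (n.-1 - j) = j)%N by lia.
apply/seteqP; split=> w /=.
  move=> /(congr1 val)/= /(digit_sum_eq _ (ltn_ord k)) Bk j jn.
  by rewrite -Bk ?rev//; lia.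
move=> Bk; apply/val_inj/(digit_sum_eq _ (ltn_ord k)) => j jn.
by rewrite Bk ?rev//; lia.
Qed.

Lemma prob_sampled_digits n (k : 'I_(2 ^ n)) :
  P (sampled_digits n @^-1` [set k]) = (weaver_weight n p k)%:E.
Proof.
rewrite sampled_digitsE (prob_bits indB PB n (fun j => odd (k %/ 2 ^ j))).
by rewrite weaver_weight_prod.
Qed.

(** Reversing the digits permutes the factors of the product that gives the
probability, so the law of the number they form is unchanged. *)
Lemma prob_sampled_rev_digits n (k : 'I_(2 ^ n)) :
  P (sampled_rev_digits n @^-1` [set k]) = (weaver_weight n p k)%:E.
Proof.
rewrite sampled_rev_digitsE.
rewrite (prob_bits indB PB n (fun j => odd (k %/ 2 ^ (n.-1 - j)))).
rewrite weaver_weight_prod (reindex_inj rev_ord_inj)/=; congr (_%:E).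
apply: eq_bigr => j _; have jn := ltn_ord j.
by have -> : (n.-1 - (n - j.+1) = j)%N by lia.
Qed.

(** The way in which the sample mean and the random binary expansion are both
compared with W(n,p): kappa is a source of digits with the law of W(n,p),
and Y is close to the point of W(n,p) that it selects. *)
Lemma distr_near_weaver_cdf n (kappa : T -> 'I_(2 ^ n)) (Y : {RV P >-> R})
    (delta c : R) :
  (forall k, measurable (kappa @^-1` [set k])) ->
  (forall k, P (kappa @^-1` [set k]) = (weaver_weight n p k)%:E) ->
  0 <= c ->
  (forall k : 'I_(2 ^ n),
    (P ([set w | (delta <= `|Y w - weaver_point n k|)%R]
        `&` kappa @^-1` [set k]) <= c%:E * P (kappa @^-1` [set k]))%E) ->
  forall x,
  weaver_cdf p n (x - delta) - c <= fine (distr_fun (distribution P Y) x) <=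
  weaver_cdf p n (x + delta) + c.
Proof.
move=> mk Pk c0 Yc x.
have mixE z : distr_fun (fun A => \sum_(k < 2 ^ n)
    P (kappa @^-1` [set k]) * \d_(weaver_point n k) A)%E z =
    (weaver_cdf p n z)%:E.
  by rewrite -distr_fun_weaver; apply: eq_bigr => k _; rewrite Pk.
have Ffin : distr_fun (distribution P Y) x \is a fin_num.
  exact: fin_num_measure.
have := le_distr_mixture mk c0 Yc x; have := ge_distr_mixture mk c0 Yc x.
rewrite !mixE -(fineK Ffin) -!EFinD !lee_fin => h1 h2.
by rewrite lerBlDr h1.
Qed.

Definition binary_limit (w : T) : R := binary_value R (fun j => B j w).

Lemma measurable_binary_limit : measurable_fun setT binary_limit.
Proof.
apply: (measurable_fun_cvg (h := fun n w => binary_approx R n (fun j => B j w))).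
  elim=> [|n IH].
    rewrite (_ : (fun w => _) = cst 0)//; apply/funext => w.
    by rewrite /binary_approx /rev_digit_sum /digit_sum big_ord0 mul0r.
  rewrite (_ : (fun w => _) = fun w => binary_approx R n (fun j => B j w) +
      \1_(B n @^-1` [set true]) w / 2 ^+ n.+1); last first.
    apply/funext => w; rewrite binary_approxS indicE.
    congr (_ + _%:R / _); case Bw: (B n w).
      by rewrite mem_set.
    by rewrite memNset//= Bw.
  apply: measurable_funD => //; apply: measurable_funM => //.
  by apply: measurable_indic; exact: measurable_funPTI.
by move=> w _; exact: is_cvg_binary_approx.
Qed.

HB.instance Definition _ :=
  isMeasurableFun.Build _ _ _ _ binary_limit measurable_binary_limit.

(** The limit is within 2^-n of the point selected by its own first n digits, so
the two distribution functions agree up to shifts by 2 / 2^n, whose cost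
[weaver_cdf_increment] bounds. *)
Lemma weaver_cdf_near_binary_limit n x : (0 < n)%N ->
  `|weaver_cdf p n x - fine (distr_fun (distribution P binary_limit) x)| <=
  2 * Num.max p (1 - p) ^+ n.
Proof.
move=> n0; set q := Num.max p (1 - p).
have N1 : 0 < 2 ^+ n :> R by rewrite exprn_gt0.
(* Any delta above the 2^-n of [binary_value_weaver_point] and below
   2 / (2^n - 1) would do: no outcome is then delta-far from its point, and
   a shift by delta stays in the scope of [weaver_cdf_increment]. *)
pose delta : R := 2 / 2 ^+ n.
have dn : delta * (2 ^+ n - 1) < 2.
  rewrite /delta mulrAC ltr_pdivrMr//; lra.
have mk k : measurable (sampled_rev_digits n @^-1` [set k]).
  by rewrite sampled_rev_digitsE; exact: measurable_bits.
have far (k : 'I_(2 ^ n)) :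
    (P ([set w | (delta <= `|binary_limit w - weaver_point n k|)%R]
    `&` sampled_rev_digits n @^-1` [set k]) <=
    0%:E * P (sampled_rev_digits n @^-1` [set k]))%E.
  rewrite [X in P X](_ : _ = set0) ?measure0 ?mul0e//.
  apply/seteqP; split=> // w [/= dw kw].
  have := binary_value_weaver_point R (fun j => B j w) n0.
  have -> : rev_digit_sum n (fun j => B j w) = k by rewrite -kw.
  move=> /(le_trans dw); rewrite leNgt => /negP; apply.
  by rewrite /delta ltr_pMl ?invr_gt0// ltr1n.
have /andP[] := distr_near_weaver_cdf mk (@prob_sampled_rev_digits n) (lexx 0) far x.
have := weaver_cdf_increment p0 p1 x n0 dn.
have := weaver_cdf_increment p0 p1 (x - delta) n0 dn.
by rewrite subrK -/q ler_norml; lra.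
Qed.

End weaver_law.

(** * Concentration of the sample mean given the digits *)

Lemma sample_meanE d (T : measurableType d) (R : realType)
    (P : probability T R) (X : nat -> {RV P >-> R}) n w :
  sample_mean X n w = (2 ^+ n - 1)^-1 * \sum_(1 <= i < 2 ^ n) X i w.
Proof.
rewrite mulrC; congr (_ * _).
elim: (index_iota _ _) => [|i s IH]; first by rewrite !big_nil.
by rewrite !big_cons -IH.
Qed.

Section sample_mean_deviation.
Context (R : realType) (p : R) (H0 H1 : law_on_R R).
Context d (T : measurableType d) (P : probability T R).
Context (B : nat -> {RV P >-> bool}) (X : nat -> {RV P >-> R}).
Hypothesis BX : exponential_sampling p H0 H1 B X.
Hypotheses (p0 : 0 < p) (p1 : p < 1).
Hypotheses (H0_int : H0.-integrable setT (fun x : R => x%:E))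
  (H1_int : H1.-integrable setT (fun x : R => x%:E))
  (H0_mean : ('E_H0[fun x => x] = 0)%E)
  (H1_mean : ('E_H1[fun x => x] = 1)%E).
Variable v : R.
Hypotheses (H0_var : ('V_H0[fun x => x] <= v%:E)%E)
  (H1_var : ('V_H1[fun x => x] <= v%:E)%E).

(** Chebyshev's inequality under the conditional probability given the first n
digits, for which the sample mean has expectation [weaver_point n k] and
variance at most v / (2^n - 1). *)
Lemma sample_mean_deviation n (k : 'I_(2 ^ n)) delta : (0 < n)%N -> 0 < delta ->
  (P ([set w | (delta <= `|sample_mean X n w - weaver_point n k|)%R]
      `&` sampled_digits B n @^-1` [set k]) <=
   (v / delta ^+ 2 / (2 ^+ n - 1))%:E * P (sampled_digits B n @^-1` [set k]))%E.
Proof.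
move=> n0 delta0; have [indB PB condX] := BX.
set C := _ @^-1` [set k].
have PC : (0 < P C)%E.
  by rewrite /C (prob_sampled_digits indB PB) lte_fin weaver_weight_gt0.
have mC : measurable C by rewrite /C sampled_digitsE; exact: measurable_bits.
have [Q QE] := cond_prob_probability mC PC.
pose b j := odd (k %/ 2 ^ j).
have := condX n b.
rewrite -[[set w | _]]/[set w | forall j, (j < n)%N ->
  B j w = odd (k %/ 2 ^ j)].
rewrite -sampled_digitsE -/C -QE /= => -[indX lawX].
pose s := index_iota 1 (2 ^ n).
have sP i : (i \in s) = (1 <= i < 2 ^ n)%N by rewrite mem_index_iota.
pose Z i : {RV Q >-> R} := X i.
pose H (c : bool) := if c then H1 else H0.
have lawZ i : i \in s ->
    forall A : set R, measurable A -> Q (Z i @^-1` A) = H (b (trunc_log 2 i)) A.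
  by rewrite sP /H => /lawX lawXi A /lawXi ->; case: (b _).
have EZ i : i \in s -> ('E_Q[Z i] = (b (trunc_log 2 i))%:R%:E)%E.
  by move=> /lawZ; rewrite /H; case: (b _) => /expectation_law ->.
have VZ i : i \in s -> ('V_Q[Z i] <= v%:E)%E.
  by move=> /lawZ; rewrite /H; case: (b _) => /variance_law ->.
have Z2 i : i \in s -> (Z i : T -> R) \in Lfun Q 2%:E.
  by move=> si; apply: variance_lty_Lfun2; rewrite (le_lt_trans (VZ i si)) ?ltry.
have indZ i j : i \in s -> j \in s -> i != j -> independent_pair Q (Z i) (Z j).
  rewrite !sP => si sj ij A A' mA mA'.
  pose AA l := if l == i then A else A'.
  have AAj : AA j = A' by rewrite /AA eq_sym (negbTE ij).
  have AAi : AA i = A by rewrite /AA eqxx.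
  have mAA l : measurable (AA l) by rewrite /AA; case: ifP.
  have subJ : [set` [fset i; j]%fset] `<=` [set l | (1 <= l < 2 ^ n)%N].
    by move=> l /=; rewrite !inE => /orP[/eqP ->|/eqP ->].
  have := indX _ subJ AA mAA.
  rewrite (perm_big [:: i; j]); last first.
    apply: uniq_perm; [exact: fset_uniq|by rewrite /= inE ij|].
    by move=> l; rewrite !inE.
  rewrite !big_cons big_nil /= mule1 AAi AAj => <-.
  congr (Q _); apply/seteqP; split=> w /=.
    move=> [Aw A'w] l; rewrite /= !inE => /orP[/eqP ->|/eqP ->].
      by rewrite AAi.
    by rewrite AAj.
  move=> Aw; split.
    by rewrite -AAi; apply: Aw; rewrite /= !inE eqxx.
  by rewrite -AAj; apply: Aw; rewrite /= !inE eqxx orbT.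
have sizes : size s = (2 ^ n - 1)%N by rewrite size_iota.
have N0 : 0 < 2 ^+ n - 1 :> R by rewrite subr_gt0 exprn_egt1// -?lt0n// ltr1n.
have N1 : ((2 ^ n - 1)%N%:R = 2 ^+ n - 1 :> R).
  by rewrite natrB ?expn_gt0// natrX.
pose S : {RV Q >-> R} := sample_mean X n.
have SE : (S : T -> R) = (2 ^+ n - 1)^-1 \o* (fun w => \sum_(i <- s) Z i w).
  by apply/funext => w; rewrite /S sample_meanE /= mulrC.
have Qfin : Q setT \is a fin_num := fin_num_measure Q _ measurableT.
have Sum2 := sum_Lfun2 Z2.
have ES : fine ('E_Q[S])%E = weaver_point n k.
  rewrite SE expectationZl ?(Lfun_subset12 Qfin Sum2)//.
  rewrite expectation_sum_seq// big_seq (eq_bigr _ EZ) -big_seq sumEFin -EFinM/=.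
  rewrite -natr_sum sum_trunc_log digit_sum_digits// /weaver_point mulrC.
  by [].
have VS : ('V_Q[S] <= (v / (2 ^+ n - 1))%:E)%E.
  rewrite SE varianceZ// variance_sum_independent ?iota_uniq//.
  have sumV : (\sum_(i <- s) 'V_Q[Z i] <= ((2 ^+ n - 1) * v)%:E)%E.
    have -> : (2 ^+ n - 1) * v = \sum_(i <- s) v.
      by rewrite big_const_seq count_predT iter_addr addr0 sizes -N1 mulr_natl.
    by rewrite -sumEFin big_seq [leRHS]big_seq; exact: lee_sum.
  apply: (le_trans (lee_wpmul2l _ sumV)); first by rewrite lee_fin sqr_ge0.
  rewrite -EFinM lee_fin expr2 mulrA -(mulrA _ _ (2 ^+ n - 1)).
  by rewrite mulVf ?gt_eqF// mulr1 mulrC.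
have PQ A : (P (A `&` C) = Q A * P C)%E.
  have PCfin : P C \is a fin_num by exact: fin_num_measure.
  rewrite QE /cond_prob -muleA.
  have -> : ((P C)^-1 * P C = 1)%E.
    by rewrite -(fineK PCfin) inver gt_eqF ?fine_gt0 ?PC ?ltey_eq ?PCfin// -EFinM
      mulVf// gt_eqF// fine_gt0// PC ltey_eq PCfin.
  by rewrite mule1.
rewrite PQ; apply: lee_wpmul2r; first exact: measure_ge0.
have := chebyshev S delta0; rewrite ES => /le_trans; apply.
apply: (le_trans (lee_wpmul2l _ VS)).
  by rewrite lee_fin invr_ge0 sqr_ge0.
by rewrite -EFinM lee_fin mulrA (mulrC _ v).
Qed.
End sample_mean_deviation.

(** * Convergence in distribution *)

(** The convergence is only assumed for each fixed shift delta: delta is first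
chosen by the continuity of F at x, and n large afterwards. *)
Lemma cvg_between_shifts (R : realType) (F : R -> R) (Fn : nat -> R -> R)
    (G : nat -> R) (c : R -> nat -> R) (x : R) :
  (forall y, Fn n y @[n --> \oo] --> F y) -> {for x, continuous F} ->
  (forall delta, 0 < delta -> c delta n @[n --> \oo] --> 0) ->
  (forall delta n, 0 < delta -> (0 < n)%N ->
    Fn n (x - delta) - c delta n <= G n <= Fn n (x + delta) + c delta n) ->
  G n @[n --> \oo] --> F x.
Proof.
move=> FnF Fx c0 FGF; apply/cvgrPdist_le => e e0.
have e30 : 0 < e / 3 by rewrite divr_gt0.
have /cvgrPdist_le/(_ _ e30)/nbhs_ballP[d /= d0 Fd] := Fx.
pose delta := d / 2; have delta0 : 0 < delta by rewrite divr_gt0.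
have Fp : `|F x - F (x + delta)| <= e / 3.
  apply: Fd; rewrite /ball/= opprD addNKr normrN gtr0_norm// /delta; lra.
have Fm : `|F x - F (x - delta)| <= e / 3.
  apply: Fd; rewrite /ball/= opprB addrC subrK gtr0_norm// /delta; lra.
have /cvgrPdist_le/(_ _ e30) Fnp := FnF (x + delta).
have /cvgrPdist_le/(_ _ e30) Fnm := FnF (x - delta).
have /cvgrPdist_le/(_ _ e30) cn := c0 _ delta0.
near=> n; have n0 : (0 < n)%N by near: n; exists 1%N.
have /andP[] := FGF delta n delta0 n0.
have : `|F (x + delta) - Fn n (x + delta)| <= e / 3 by near: n.
have : `|F (x - delta) - Fn n (x - delta)| <= e / 3 by near: n.
have : `|0 - c delta n| <= e / 3 by near: n.
move: Fp Fm; rewrite !ler_norml; lra.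
Unshelve. all: by end_near. Qed.

Section hem.
Context d (T : measurableType d) (R : realType) (P : probability T R).
Context (p : R) (B : nat -> {RV P >-> bool}).
Hypothesis indB : mutually_independent P setT (fun j => B j : T -> bool).
Hypothesis PB : forall j, P [set w | B j w = true] = p%:E.
Hypotheses (p0 : 0 < p) (p1 : p < 1).

Lemma cvg_weaver_cdf x : weaver_cdf p n x @[n --> \oo] -->
  fine (distr_fun (distribution P (binary_limit B)) x).
Proof.
set q := Num.max p (1 - p).
have q1 : `|q| < 1.
  have q0 : 0 <= q by rewrite le_max (ltW p0).
  by rewrite ger0_norm// gt_max p1 gtrBl.
have q0 : geometric 2 q n @[n --> \oo] --> 0 by exact: cvg_geometric.
apply/cvgrPdist_le => e e0.
have /cvgrPdist_le/(_ _ e0) qe := q0.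
near=> n; have n0 : (0 < n)%N by near: n; exists 1%N.
rewrite distrC (le_trans (weaver_cdf_near_binary_limit indB PB p0 p1 x n0))//.
rewrite -/q (le_trans (ler_norm _))// -normrN -[- _]add0r.
by near: n.
Unshelve. all: by end_near. Qed.

(** The law of [binary_limit] witnesses that the choice defining [weavers_hem]
ranges over a nonempty set, so the chosen law has the limit property. *)
Lemma cvg_weavers_hem x : weaver_cdf p n x @[n --> \oo] -->
  fine (distr_fun (weavers_hem p) x).
Proof.
have : exists W : law_on_R R, forall x,
    distr_fun (weaver n p) x @[n --> \oo] --> distr_fun W x.
  exists (distribution P (binary_limit B)) => y.
  have Ffin : distr_fun (distribution P (binary_limit B)) y \is a fin_num.
    exact: fin_num_measure.
  rewrite -(fineK Ffin); under eq_fun do rewrite distr_fun_weaver.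
  by apply: cvg_EFin; [exact: nearW|exact: cvg_weaver_cdf].
move=> /(xgetPex (@dirac _ R 0 R : law_on_R R)) /(_ x).
rewrite -/(weavers_hem p); under eq_fun do rewrite distr_fun_weaver.
have Ffin : distr_fun (weavers_hem p) x \is a fin_num by exact: fin_num_measure.
by rewrite -{1}(fineK Ffin) => /fine_cvg.
Qed.
End hem.

Theorem theorem13 (R : realType) (p : R) (p_gt0 : 0 < p) (p_lt1 : p < 1)
  (H0 H1 : law_on_R R)
  (H0_int : H0.-integrable setT (fun x : R => x%:E))
  (H1_int : H1.-integrable setT (fun x : R => x%:E))
  (H0_mean : ('E_H0[fun x => x] = 0)%E)
  (H1_mean : ('E_H1[fun x => x] = 1)%E)
  (H0_var : ('V_H0[fun x => x] < +oo)%E)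
  (H1_var : ('V_H1[fun x => x] < +oo)%E)
  (d : measure_display) (T : measurableType d) (P : probability T R)
  (B : nat -> {RV P >-> bool}) (X : nat -> {RV P >-> R})
  (BX : exponential_sampling p H0 H1 B X) :
  cvg_in_distribution (fun n => distribution P (sample_mean X n))
    (weavers_hem p).
Proof.
have [indB PB _] := BX.
have fin_var (H : law_on_R R) : ('V_H[fun x => x] < +oo)%E ->
    'V_H[fun x => x]%E = (fine 'V_H[fun x => x]%E)%:E.
  by move=> Hv; rewrite fineK// ge0_fin_numE// variance_ge0.
pose v := Num.max (fine 'V_H0[fun x => x]%E) (fine 'V_H1[fun x => x]%E).
have v0 : 0 <= v by rewrite le_max fine_ge0// variance_ge0.
have V0 : ('V_H0[fun x => x] <= v%:E)%E.
  by rewrite fin_var// lee_fin le_max lexx.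
have V1 : ('V_H1[fun x => x] <= v%:E)%E.
  by rewrite fin_var// lee_fin le_max lexx orbT.
move=> x Wx.
have fin_distr (Q : law_on_R R) y : distr_fun Q y \is a fin_num.
  exact: fin_num_measure.
have -> : (fun n => distr_fun (distribution P (sample_mean X n)) x) =
    (fun n => (fine (distr_fun (distribution P (sample_mean X n)) x))%:E).
  by apply/funext => n; rewrite fineK.
rewrite -(fineK (fin_distr (weavers_hem p) x)).
apply: cvg_EFin; first exact: nearW.
(* A geometric majorant of v / delta^2 / (2^n - 1), valid because
   2^n <= 2 (2^n - 1) for n > 0. *)
pose c delta n := geometric (2 * (v / delta ^+ 2)) 2^-1 n.
apply: (@cvg_between_shifts _ (fine \o distr_fun (weavers_hem p))
  (weaver_cdf p) _ c).
- by move=> y; exact: (cvg_weavers_hem indB PB p_gt0 p_lt1).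
- by apply: fine_cvg; rewrite fineK.
- move=> delta _; apply: cvg_geometric.
  by rewrite gtr0_norm ?invr_gt0// invf_lt1// ltr1n.
move=> delta n delta0 n0.
have N1 : 2 <= 2 ^+ n :> R by rewrite -[leLHS]expr1 ler_weXn2l// ler1n.
have c_ge : v / delta ^+ 2 / (2 ^+ n - 1) <= c delta n.
  have -> : c delta n = v / delta ^+ 2 * (2 / 2 ^+ n).
    by rewrite /c/= exprVn (mulrC 2) mulrA.
  apply: ler_wpM2l; first by rewrite divr_ge0// sqr_ge0.
  by rewrite -[2 / _]invf_div lef_pV2 ?posrE ?divr_gt0//; lra.
apply: (distr_near_weaver_cdf (kappa := sampled_digits B n)).
- by move=> k; rewrite sampled_digitsE; exact: measurable_bits.
- exact: (prob_sampled_digits indB PB).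
- by rewrite mulr_ge0 ?exprn_ge0 ?invr_ge0// mulr_ge0// divr_ge0// sqr_ge0.
move=> k; apply: (le_trans (sample_mean_deviation BX p_gt0 p_lt1
  H0_int H1_int H0_mean H1_mean V0 V1 k n0 delta0)).
by rewrite lee_wpmul2r// lee_fin.
Qed.
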